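(* Let $N\ge2$ and $k\in\{2,\dots,N\}$. For every partition $\mathbf p'$ of $k$, the coefficient $c_{\mathbf p'}$ in the expansion $$\mu_k=\sum_{\mathbf p'\text{ partition of }k}c_{\mathbf p'}\,S_k\,\mathrm{id}^{\otimes p'_1}_\#\lambda\otimes\cdots\otimes\mathrm{id}^{\otimes p'_{n(\mathbf p')}}_\#\lambda$$ of extremal $N$-representable $k$-point measures $\mu_k$ in terms of their one-point marginal $\lambda$, that is $$c_{\mathbf p'}=(-1)^{k-n(\mathbf p')}\frac{k!}{N(N-1)\cdots(N-k+1)}N^{n(\mathbf p')}\frac1{p'_1\cdots p'_{n(\mathbf p')}}\cdot\frac1{\prod_{q\in\mathrm{Ran}\,\mathbf p'}(|\mathbf p'^{-1}(q)|)!},$$ is given by $$c_{\mathbf p'}=\mathtt{ew}(\mathbf p';\theta)\big|_{\theta=-N},$$ where $\mathtt{ew}$ is the complex Ewens function.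
   Context: A partition of $k\in\mathbb N=\{1,2,\dots\}$ of length $n$ is $\mathbf p'=(p'_1\ge\dots\ge p'_n)\in\mathbb N^n$ with $\sum p'_i=k$; $n(\mathbf p')=n$; $\mathrm{Ran}\,\mathbf p'$ is the set of values of its components and $|\mathbf p'^{-1}(q)|$ is the number of components equal to $q$. The complex Ewens function is, for $\theta\in\mathbb C$, $$\mathtt{ew}(\mathbf p';\theta):=\frac{k!}{\theta(\theta+1)\cdots(\theta+k-1)}\,\theta^{n(\mathbf p')}\prod_{i=1}^{n(\mathbf p')}\frac1{p'_i}\cdot\frac1{\prod_{q\in\mathrm{Ran}\,\mathbf p'}(|\mathbf p'^{-1}(q)|)!}.$$ On a finite state space $X$, the extremal $N$-representable $k$-point measures are the measures $\mu_k=M_kS_N\delta_{(x_1,\dots,x_N)}$, $(x_1,\dots,x_N)\in X^N$, with one-point marginal $\lambda=\frac1N\sum_i\delta_{x_i}$; here $S_N$ is symmetrization (average over all coordinate permutations), likewise $S_k$ on $X^k$; $M_k$ is the $k$-point marginal map (onto the first $k$ coordinates), and $\mathrm{id}^{\otimes m}_\#\lambda$ is the push-forward of $\lambda$ under $x\mapsto(x,\dots,x)\in X^m$. *)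

(* Defs.v *)
From HB Require Import structures.
From mathcomp Require Import all_boot all_order all_algebra all_fingroup.
From mathcomp Require Import reals complex.

Set Implicit Arguments.
Unset Strict Implicit.
Unset Printing Implicit Defensive.

Import Order.TTheory GRing.Theory Num.Theory.

Local Open Scope ring_scope.

Definition is_partition (k : nat) (p : seq nat) : bool :=
  [&& sorted geq p, all (ltn 0) p & sumn p == k].

Record intpartn (k : nat) := IntPartn {
  parts :> seq nat;
  partsP : is_partition k parts }.

HB.instance Definition _ k := [isSub for @parts k].
HB.instance Definition _ k := [Countable of intpartn k by <:].

Lemma sumn_intpartn k (p : intpartn k) : sumn p = k.
Proof. by case/and3P: (partsP p) => _ _ /eqP. Qed.

Lemma size_intpartn k (p : intpartn k) : (size p <= k)%N.
Proof.
rewrite -[X in (_ <= X)%N](sumn_intpartn p).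
case/and3P: (partsP p) => _ + _.
elim: (parts p) => //= a s IHs /andP[a_gt0 /IHs le_s].
by rewrite -add1n leq_add.
Qed.

Lemma mem_intpartn_le k (p : intpartn k) q : q \in parts p -> (q <= k)%N.
Proof.
rewrite -[X in _ -> (_ <= X)%N](sumn_intpartn p).
elim: (parts p) => //= a s IHs; rewrite inE => /orP[/eqP-> | /IHs le_q].
  exact: leq_addr.
exact: leq_trans le_q (leq_addl _ _).
Qed.

Definition intpartn_code k (p : intpartn k) : k.-bseq 'I_k.+1 :=
  insub_bseq k [seq inord q | q <- p].
Definition intpartn_decode k (b : k.-bseq 'I_k.+1) : option (intpartn k) :=
  insub [seq val i | i <- b].

Lemma intpartn_codeK k : pcancel (@intpartn_code k) (@intpartn_decode k).
Proof.
move=> p; rewrite /intpartn_decode /intpartn_code.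
have -> : [seq val i | i <- insub_bseq k [seq (inord q : 'I_k.+1) | q <- p]]
            = parts p.
  rewrite /insub_bseq insubdK ?unfold_in ?size_map ?size_intpartn //.
  rewrite -map_comp -[RHS]map_id; apply/eq_in_map => q /mem_intpartn_le le_q /=.
  by rewrite inordK.
exact: valK.
Qed.

HB.instance Definition _ k : isFinite (intpartn k) :=
  PCanIsFinite (@intpartn_codeK k).

Section PartitionWeights.
Variables (R : realType) (k : nat).

Definition ew (p : intpartn k) (theta : R[i]) : R[i] :=
  (k`!)%:R / (\prod_(j < k) (theta + j%:R))
  * theta ^+ size p
  * (\prod_(q <- p) q%:R^-1)
  * (\prod_(q <- undup p) (count_mem q p)`!%:R)^-1.

(* [N ^_ k] is N (N - 1) ... (N - k + 1), and [size p <= k], so the natural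
   subtraction [k - size p] does not truncate. *)
Definition coef (N : nat) (p : intpartn k) : R :=
  (-1) ^+ (k - size p)
  * ((k`!)%:R / (N ^_ k)%:R)
  * N%:R ^+ size p
  * (\prod_(q <- p) q%:R)^-1
  * (\prod_(q <- undup p) (count_mem q p)`!%:R)^-1.

End PartitionWeights.

(* A signed measure on a finite set is represented by its values on points,
   and [X ^ n] by [{ffun 'I_n -> X}]. *)
Section FiniteMeasures.
Variable R : realType.

Definition fmeas (T : finType) := {ffun T -> R^o}.

Definition fdirac (T : finType) (a : T) : fmeas T := [ffun b => (a == b)%:R : R].

Definition push (T U : finType) (f : T -> U) (mu : fmeas T) : fmeas U :=
  [ffun u => \sum_(t | f t == u) mu t].

Definition fprod_meas (T U : finType) (mu : fmeas T) (nu : fmeas U) :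
  fmeas (T * U)%type := [ffun z => mu z.1 * nu z.2].

Variable X : finType.

Local Notation Xpow n := {ffun 'I_n -> X}.

Definition concat (m n : nat) (z : (Xpow m * Xpow n)%type) : Xpow (m + n) :=
  [ffun i => match split i with inl j => z.1 j | inr j => z.2 j end].

Definition tensor (m n : nat) (mu : fmeas (Xpow m)) (nu : fmeas (Xpow n)) :
  fmeas (Xpow (m + n)) := push (@concat m n) (fprod_meas mu nu).

Definition symm (n : nat) (mu : fmeas (Xpow n)) : fmeas (Xpow n) :=
  (n`!)%:R^-1 *: \sum_(s : 'S_n) push (fun x : Xpow n => [ffun i => x (s i)]) mu.

Definition marginal (N k : nat) (hkN : (k <= N)%N) (mu : fmeas (Xpow N)) :
  fmeas (Xpow k) := push (fun x : Xpow N => [ffun i => x (widen_ord hkN i)]) mu.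

Definition diag (m : nat) (x : X) : Xpow m := [ffun=> x].

Fixpoint diag_tensor (lambda : fmeas X) (p : seq nat) : fmeas (Xpow (sumn p)) :=
  match p with
  | [::] => fdirac (ffun0 (card_ord 0))
  | q :: p' => tensor (push (diag q) lambda) (diag_tensor lambda p')
  end.

(* [diag_tensor lambda p] lives on [X ^ (sumn p)]; reindex it along
   [sumn p = k]. *)
Definition intpartn_tensor (k : nat) (lambda : fmeas X) (p : intpartn k) :
  fmeas (Xpow k) :=
  push (fun x : Xpow (sumn p) => [ffun i => x (cast_ord (esym (sumn_intpartn p)) i)])
    (diag_tensor lambda p).

Definition extremal (N k : nat) (hkN : (k <= N)%N) (x : Xpow N) : fmeas (Xpow k) :=
  marginal hkN (symm (fdirac x)).

Definition one_point (N : nat) (x : Xpow N) : fmeas X :=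
  N%:R^-1 *: \sum_(i < N) fdirac (x i).

Lemma push_comp (T U V : finType) (f : T -> U) (g : U -> V) (mu : fmeas T) :
  push g (push f mu) = push (g \o f) mu.
Proof.
apply/ffunP => v; rewrite !ffunE.
rewrite (partition_big f (fun u => g u == v)) //=.
apply: eq_bigr => u /eqP gu; rewrite ffunE; apply: eq_bigl => t.
by case: eqP => [->|]; rewrite ?gu ?eqxx ?andbF.
Qed.

Lemma push_dirac (T U : finType) (f : T -> U) (a : T) :
  push f (fdirac a) = fdirac (f a).
Proof.
apply/ffunP => u; rewrite !ffunE.
under eq_bigr do rewrite ffunE.
rewrite big_mkcond (bigD1 a) //= eqxx big1 => [|t /negPf ta]; last first.
  by rewrite eq_sym in ta; rewrite ta; case: ifP.
by rewrite addr0; case: ifP.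
Qed.

Lemma push_scale_sum (T U I : finType) (f : T -> U) (c : R) (mu : I -> fmeas T) :
  push f (c *: \sum_i mu i) = c *: \sum_i push f (mu i).
Proof.
apply/ffunP => u; rewrite !(ffunE, sum_ffunE).
under eq_bigr do rewrite ffunE sum_ffunE.
rewrite -scaler_sumr exchange_big; congr (_ *: _).
by apply: eq_bigr => i _; rewrite ffunE.
Qed.

(* [one_point x] is the one-point marginal of [extremal hkN x]. *)
Lemma one_point_marginal (N k : nat) (hkN : (k <= N)%N) (x : Xpow N) (i : 'I_k) :
  push (fun y : Xpow k => y i) (extremal hkN x) = one_point x.
Proof.
rewrite /extremal /marginal /symm /one_point !push_comp push_scale_sum.
set j := widen_ord hkN i.
have E s : push ((fun y : Xpow k => y i) \o
      (fun y : Xpow N => [ffun i0 => y (widen_ord hkN i0)]))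
      (push (fun y : Xpow N => [ffun i0 => y (s i0)]) (fdirac x))
    = fdirac (x (s j)) by rewrite !push_dirac /= !ffunE.
under eq_bigr do rewrite E.
have N_gt0 : (0 < N)%N by apply: leq_ltn_trans (ltn_ord j).
have N0 : N%:R != 0 :> R by rewrite pnatr_eq0 -lt0n.
have f0 : N`!%:R != 0 :> R by rewrite pnatr_eq0 -lt0n fact_gt0.
have indep (l : 'I_N) :
    \sum_(s : 'S_N) fdirac (x (s l)) = \sum_(s : 'S_N) fdirac (x (s j)).
  rewrite (reindex_inj (mulgI (tperm j l))) /=.
  by apply: eq_bigr => s _; rewrite permM tpermR.
have NS : N%:R *: (\sum_(s : 'S_N) fdirac (x (s j)))
    = N`!%:R *: \sum_(l < N) fdirac (x l) :> fmeas X.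
  have cst (I : finType) (v : fmeas X) : \sum_(l : I) v = #|I|%:R *: v.
    by rewrite scaler_nat -sumr_const.
  have := cst 'I_N (\sum_(s : 'S_N) fdirac (x (s j))); rewrite card_ord => <-.
  have := cst 'S_N (\sum_(l < N) fdirac (x l)); rewrite card_Sn => <-.
  rewrite -(eq_bigr _ (fun l _ => indep l)).
  rewrite exchange_big /=.
  by apply: eq_bigr => s _; rewrite [RHS](reindex_inj (@perm_inj _ s)).
by apply: (scalerI N0); rewrite scalerA mulrC -scalerA NS !scalerA mulVf ?mulfV.
Qed.

End FiniteMeasures.

(* Main.v *)
(* A measure mu on X^k is encoded as the polynomial sum_y mu(y) t_(y_1)...t_(y_k)
   in commuting variables indexed by X. This encoding is injective on
   permutation-invariant measures, ignores symmetrization, and sends tensor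
   products to products. With u_i = t_(x_i), the extremal measure becomes
   e_k(u) / C(N, k), and the push-forward of lambda to the diagonal of X^q
   becomes p_q(u) / N, so the expansion is the classical formula expressing
   e_k in terms of the power sums. Both sides of that formula satisfy Newton's
   recursion k e_k = sum_i (-1)^i p_(i+1) e_(k-1-i). *)

Require Import Defs.
From HB Require Import structures.
From mathcomp Require Import all_boot all_order all_algebra all_fingroup.
From mathcomp Require Import reals complex.
From mathcomp Require Import mpoly ring.

Import Order.TTheory GRing.Theory Num.Theory.
Local Open Scope ring_scope.
Local Open Scope complex_scope.

Set Implicit Arguments.
Unset Strict Implicit.
Unset Printing Implicit Defensive.

(** * Partitions and removal of a part *)

(** For positive parts this is the classical $z_s$, the order of the centralizer of a permutation of
    cycle type [s]. *)
Definition zpart (s : seq nat) : nat :=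
  \prod_(q <- s) q * \prod_(q <- undup s) (count_mem q s)`!.

Lemma zpart_perm (s t : seq nat) : perm_eq s t -> zpart s = zpart t.
Proof.
move=> st; rewrite /zpart (perm_big _ st) /=; congr (_ * _)%N.
rewrite (perm_big _ (perm_undup (perm_mem st))) /=.
by apply: eq_bigr => q _; rewrite (seq.permP st).
Qed.

Lemma zpart_cons (q : nat) (s : seq nat) :
  zpart (q :: s) = (q * (count_mem q s).+1 * zpart s)%N.
Proof.
have rest (r : seq nat) : q \notin r ->
    (\prod_(j <- r) (count_mem j (q :: s))`! = \prod_(j <- r) (count_mem j s)`!)%N.
  move=> qr; apply: eq_big_seq => j jr /=.
  by rewrite (_ : (q == j) = false) //; apply: contraNF qr => /eqP->.
rewrite /zpart big_cons -!mulnA; congr (_ * _)%N; rewrite mulnCA; congr (_ * _)%N.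
rewrite [undup _]/=; case: ifPn => [qs|q'].
  rewrite -mem_undup in qs; rewrite !(bigD1_seq q qs) ?undup_uniq //=.
  rewrite eqxx add1n factS -mulnA; congr (_ * (_ * _))%N.
  by apply: eq_bigr => j jq; rewrite eq_sym (negPf jq).
rewrite big_cons rest ?mem_undup //= eqxx add1n (count_memPn _) //.
Qed.

Lemma zpart_gt0 (s : seq nat) : all (ltn 0) s -> (0 < zpart s)%N.
Proof.
elim: s => [|q s IHs] /=; first by rewrite /zpart !big_nil.
by case/andP=> q0 /IHs s0; rewrite zpart_cons muln_gt0 s0 muln_gt0 q0.
Qed.

Lemma sumn_undup (s : seq nat) : sumn s = (\sum_(q <- undup s) q * count_mem q s)%N.
Proof.
rewrite sumnE -(perm_big _ (perm_count_undup s)) /= big_flatten big_map.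
by apply: eq_bigr => q _; rewrite big_nseq iter_addn_0.
Qed.

Lemma geq_total : total geq. Proof. by move=> m n; apply: leq_total. Qed.

Lemma geq_trans : transitive geq.
Proof. by move=> n m p nm pn; apply: leq_trans pn nm. Qed.

Lemma insert_partP (q m : nat) (p : intpartn m) :
  is_partition (q.+1 + m) (sort geq (q.+1 :: p)).
Proof.
case/and3P: (partsP p) => _ p0 /eqP sump; apply/and3P; split.
- exact/sort_sorted/geq_total.
- by rewrite all_sort /= p0.
- by rewrite (perm_sumn (permEl (perm_sort _ _))) /= sump.
Qed.

Definition insert_part (q m : nat) (p : intpartn m) : intpartn (q.+1 + m) :=
  IntPartn (insert_partP q p).

(** Inserting the part [q.+1] and sorting is a bijection, whose inverse removes one copy of [q.+1].
    Invariance of [f] under permutations lets the sorting be forgotten. *)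
Lemma sum_intpartn_mem (V : nmodType) (q m n : nat) (f : seq nat -> V) :
    (q.+1 + m = n)%N -> (forall s t, perm_eq s t -> f s = f t) ->
  \sum_(p : intpartn n | q.+1 \in parts p) f p
  = \sum_(p : intpartn m) f (q.+1 :: p).
Proof.
move=> <- fperm.
(* The inverse is partial: if [q.+1] is not a part, [rem] changes nothing and the sum is not [m]. *)
pose del (p : intpartn (q.+1 + m)) : option (intpartn m) := insub (rem q.+1 p).
rewrite (reindex_omap (@insert_part q m) del) => [|p qp]; last first.
  have perm_p := perm_to_rem qp.
  case/and3P: (partsP p) => sort_p p0 /eqP sump.
  rewrite /del; case: insubP => [p' _ def_p'|] /=; last first.
    case/negP; apply/and3P; split.
    - exact: (subseq_sorted geq_trans (rem_subseq _ _)).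
    - by apply/allP => j /mem_rem; apply/allP.
    - by rewrite -(eqn_add2l q.+1) -(perm_sumn perm_p : _ = _ + _)%N sump.
  congr Some; apply: val_inj; rewrite /= [val]/= in def_p' *; rewrite def_p'.
  apply: (sorted_eq geq_trans) => //.
  - by move=> i j; rewrite andbC => /anti_leq.
  - exact/sort_sorted/geq_total.
  by rewrite perm_sort perm_sym.
apply: eq_big => [p|p _]; last by apply/fperm; rewrite perm_sort.
rewrite /= mem_sort mem_head /del; apply/eqP; case: insubP => [p' _ def_p'|].
  congr Some; apply: val_inj; rewrite def_p' /=.
  apply: (sorted_eq geq_trans).
  - by move=> i j; rewrite andbC => /anti_leq.
  - exact: (subseq_sorted geq_trans (rem_subseq _ _)) (sort_sorted geq_total _).
  - by case/and3P: (partsP p).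
  rewrite -(perm_cons q.+1).
  apply: perm_trans (_ : perm_eq (sort geq (q.+1 :: p)) _); last by rewrite perm_sort.
  by rewrite perm_sym perm_to_rem // mem_sort mem_head.
case/negP; apply/and3P; split.
- exact: (subseq_sorted geq_trans (rem_subseq _ _)) (sort_sorted geq_total _).
- apply/allP => j /mem_rem; rewrite mem_sort; apply/allP => /=.
  by case/and3P: (partsP p).
- have e : perm_eq (sort geq (q.+1 :: p)) (q.+1 :: p) by rewrite perm_sort.
  have := perm_sumn (perm_to_rem (_ : q.+1 \in sort geq (q.+1 :: p))).
  rewrite mem_sort mem_head (perm_sumn e) /= => /(_ isT)/addnI <-.
  by rewrite sumn_intpartn.
Qed.

(** * Sums over partitions and their recursion *)

Definition part_weight (F : fieldType) (A : comAlgType F) (a : nat -> A) (s : seq nat) : A :=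
  (zpart s)%:R^-1 *: \prod_(q <- s) a q.

(** This is the cycle index of the symmetric group on [k] letters, evaluated at [a 1], [a 2], and so
    on. *)
Definition part_sum (F : fieldType) (A : comAlgType F) (a : nat -> A) (k : nat) : A :=
  \sum_(p : intpartn k) part_weight a p.

Lemma part_weight_perm (F : fieldType) (A : comAlgType F) (a : nat -> A) s t :
  perm_eq s t -> part_weight a s = part_weight a t.
Proof. by move=> st; rewrite /part_weight (zpart_perm st) (perm_big _ st). Qed.

Lemma part_sum0 (F : fieldType) (A : comAlgType F) (a : nat -> A) : part_sum a 0 = 1.
Proof.
have P0 : is_partition 0 [::] by [].
rewrite /part_sum (bigD1 (IntPartn P0)) //= big1 => [|p /eqP[]]; last first.
  by apply: val_inj; apply/nilP; rewrite /nilp -leqn0 size_intpartn.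
by rewrite addr0 /part_weight /zpart !big_nil invr1 scale1r.
Qed.

(* Since [zpart p = q * count_mem q p * zpart (rem q p)] and the products
   [q * count_mem q p] sum to [n], removing a part from [p] in all possible
   ways gives the recursion. *)
Lemma part_sumS (F : numFieldType) (A : comAlgType F) (a : nat -> A) (n : nat) :
  n.+1%:R *: part_sum a n.+1 = \sum_(i < n.+1) a i.+1 * part_sum a (n - i).
Proof.
pose g q s : A := (q * count_mem q s)%:R *: part_weight a s.
have gperm q s t : perm_eq s t -> g q s = g q t.
  by move=> st; rewrite /g (part_weight_perm _ st) (seq.permP st).
transitivity (\sum_(p : intpartn n.+1) \sum_(i < n.+1 | i.+1 \in parts p) g i.+1 p).
  rewrite /part_sum scaler_sumr; apply: eq_bigr => p _.
  have -> : n.+1%:R = (sumn p)%:R :> F by rewrite sumn_intpartn.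
  rewrite sumn_undup natr_sum scaler_suml.
  (* The shift from [i.+1] to [q] adds only the index 0, which is never a part. *)
  have E : \sum_(i < n.+1 | i.+1 \in parts p) g i.+1 p
      = \sum_(q < n.+2 | (val q) \in parts p) g q p.
    rewrite [RHS]big_mkcond big_ord_recl /= -big_mkcond /=.
    case: ifP => p0; last by rewrite add0r.
    by case/and3P: (partsP p) => _ /allP/(_ _ p0).
  rewrite {}E -(big_mkord (fun q => q \in parts p) (g^~ p)) -big_filter.
  apply: perm_big; apply: uniq_perm; rewrite ?undup_uniq ?filter_uniq ?iota_uniq //.
  move=> q; rewrite mem_undup mem_filter mem_index_iota /=.
  by case qp: (q \in _) => //=; rewrite ltnS (mem_intpartn_le qp).
rewrite (exchange_big_dep xpredT) //=; apply: eq_bigr => i _.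
rewrite (sum_intpartn_mem (subnKC (ltn_ord i)) (gperm _)) subSS.
rewrite /part_sum mulr_sumr; apply: eq_bigr => p _.
rewrite /g /part_weight big_cons -scalerAr scalerA; congr (_ *: _).
have z0 : (zpart p)%:R != 0 :> F.
  by rewrite pnatr_eq0 -lt0n zpart_gt0 //; case/and3P: (partsP p).
rewrite zpart_cons /= eqxx add1n [(_ * zpart _)%:R]natrM invfM mulrA mulfV ?mul1r //.
by rewrite pnatr_eq0.
Qed.

(** * Newton's identities through sums over permutations *)

Definition power_sum (A : comNzRingType) (N : nat) (u : 'I_N -> A) (j : nat) : A :=
  \sum_i u i ^+ j.

(** For [m <= N] this is [(N - m)!] times the sum over injections of [m] positions into the indices.
    Summing over the whole group turns each symmetry into a reindexing. *)
Definition inj_sum (A : comNzRingType) (N : nat) (u : 'I_N -> A) (m : nat) : A :=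
  \sum_(s : 'S_N) \prod_(i < N | (i < m)%N) u (s i).

(** A position [l >= m] brings in a new index, while [l < m] raises the exponent of a factor already
    present. *)
Definition inj_sum_pow (A : comNzRingType) (N : nat) (u : 'I_N -> A)
    (m : nat) (l : 'I_N) (j : nat) : A :=
  \sum_(s : 'S_N) (\prod_(i < N | (i < m)%N) u (s i)) * u (s l) ^+ j.

Lemma inj_sum_mul_power_sum (A : comNzRingType) (N : nat) (u : 'I_N -> A) m j :
  power_sum u j * inj_sum u m = \sum_l inj_sum_pow u m l j.
Proof.
rewrite mulr_sumr exchange_big; apply: eq_bigr => s _ /=.
by rewrite -mulr_sumr mulrC [power_sum u j](reindex_inj (@perm_inj _ s)).
Qed.

(** The transposition of [l] and [l'] fixes every position below [m]. *)
Lemma inj_sum_pow_ge (A : comNzRingType) (N : nat) (u : 'I_N -> A) m (l l' : 'I_N) j :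
  (m <= l)%N -> (m <= l')%N -> inj_sum_pow u m l j = inj_sum_pow u m l' j.
Proof.
move=> ml ml'; rewrite /inj_sum_pow (reindex_inj (mulgI (tperm l l'))) /=.
apply: eq_bigr => s _; rewrite permM tpermL; congr (_ * _).
apply: eq_bigr => i im; rewrite permM tpermD //.
  by apply: contraTneq im => <-; rewrite -leqNgt.
by apply: contraTneq im => <-; rewrite -leqNgt.
Qed.

(** A transposition moves the marked position to [m], the last one in the product, whose factor is
    then absorbed into the power. *)
Lemma inj_sum_pow_le (A : comNzRingType) (N : nat) (u : 'I_N -> A) (m l : 'I_N) j :
  (l <= m)%N -> inj_sum_pow u m.+1 l j = inj_sum_pow u m m j.+1.
Proof.
move=> lm; rewrite /inj_sum_pow (reindex_inj (mulgI (tperm l m))) /=.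
apply: eq_bigr => s _; rewrite permM tpermL.
(* Reindexing the product by the same transposition undoes its effect there, since it preserves the
   positions [0..m]. *)
rewrite (reindex_inj (@perm_inj _ (tperm l m))) /=.
under eq_bigr do rewrite permM tpermK.
have E (i : 'I_N) : (tperm l m i < m.+1)%N = (i < m.+1)%N.
  by case: tpermP => [->|->|//]; rewrite !ltnS lm leqnn.
rewrite (bigD1 m) /=; last by rewrite E ltnS.
rewrite mulrAC -exprS mulrC; congr (_ * _); apply: eq_bigl => i.
by rewrite E ltnS ltn_neqAle andbC.
Qed.

Lemma inj_sumS (A : comNzRingType) (N : nat) (u : 'I_N -> A) (m : 'I_N) :
  inj_sum u m.+1 = inj_sum_pow u m m 1.
Proof.
rewrite -(@inj_sum_pow_le _ _ u m m 0 (leqnn m)).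
by apply: eq_bigr => s _; rewrite mulr1.
Qed.

Lemma sum_ord_ge (V : nmodType) (N : nat) (m : nat) (c : V) :
  \sum_(i < N | (m <= i)%N) c = c *+ (N - m).
Proof. by rewrite -(big_geq_mkord m N xpredT (fun=> c)) big_const_nat iter_addr_0. Qed.

Lemma sum_ord_lt (V : nmodType) (N : nat) (m : nat) (c : V) :
  (m <= N)%N -> \sum_(i < N | (i < m)%N) c = c *+ m.
Proof. by move=> mN; rewrite -(big_ord_widen N (fun=> c) mN) sumr_const card_ord. Qed.

Lemma inj_sum_newton0 (A : comNzRingType) (N : nat) (u : 'I_N -> A) (m : 'I_N) j :
  m = 0%N :> nat -> power_sum u j * inj_sum u m = inj_sum_pow u m m j *+ N.
Proof.
move=> m0; rewrite inj_sum_mul_power_sum -[X in _ *+ X](card_ord N) -sumr_const.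
by apply: eq_bigr => l _; apply: inj_sum_pow_ge; rewrite m0.
Qed.

(** The marked position is either one of the [m.+1] already used or one of the [N - m'] free ones;
    within each class all positions contribute equally. *)
Lemma inj_sum_newtonS (A : comNzRingType) (N : nat) (u : 'I_N -> A) (m m' : 'I_N) j :
    m' = m.+1 :> nat ->
  power_sum u j * inj_sum u m'
  = inj_sum_pow u m m j.+1 *+ m.+1 + inj_sum_pow u m' m' j *+ (N - m').
Proof.
move=> Em; rewrite inj_sum_mul_power_sum (bigID (fun l : 'I_N => l < m')%N) /=.
congr (_ + _).
  rewrite Em -(sum_ord_lt _ (ltn_ord m)).
  by apply: eq_bigr => l lm; apply: inj_sum_pow_le.
rewrite -sum_ord_ge; under eq_bigl do rewrite -leqNgt.
by apply: eq_bigr => l lm; apply: inj_sum_pow_ge.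
Qed.

Lemma natfMV (F : numFieldType) (n c : nat) :
  (n.+1 * c)%:R^-1 * n.+1%:R = c%:R^-1 :> F.
Proof. by rewrite natrM invfM mulrAC mulVf ?mul1r ?pnatr_eq0. Qed.

(* The elementary symmetric function: each subset of [m] indices is the image
   of the first [m] ones under [m! (N - m)!] permutations. *)
Definition elem_sym (F : fieldType) (A : comAlgType F) (N : nat) (u : 'I_N -> A)
    (m : nat) : A :=
  (m`! * (N - m)`!)%:R^-1 *: inj_sum u m.

Lemma elem_sym0 (F : numFieldType) (A : comAlgType F) (N : nat) (u : 'I_N -> A) :
  elem_sym u 0 = 1.
Proof.
rewrite /elem_sym /inj_sum; under eq_bigr do rewrite big_pred0_eq.
rewrite sumr_const card_Sn fact0 mul1n subn0 -scaler_nat scalerA mulVf ?scale1r //.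
by rewrite pnatr_eq0 -lt0n fact_gt0.
Qed.

(* Solving p_j e_m = g_(m, j) + g_(m - 1, j + 1) for g_(m, j), where
   g_(m, j) = sum_l e_m(u without u_l) u_l^j. *)
Lemma elem_sym_pow_sum (F : numFieldType) (A : comAlgType F) (N : nat) (u : 'I_N -> A)
    (m : 'I_N) j :
  (m`! * (N - m).-1`!)%:R^-1 *: inj_sum_pow u m m j
  = \sum_(i < m.+1) (-1) ^+ i * power_sum u (j + i) * elem_sym u (m - i).
Proof.
(* The exponent [j] stays general, as the induction step appeals to [j.+1]. *)
case: m j; elim=> [|m IHm] mN j.
  rewrite big_ord1 mul1r addn0 /= subn0 /elem_sym -scalerAr.
  rewrite (@inj_sum_newton0 _ _ u (Ordinal mN)) // -scaler_nat scalerA.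
  congr (_ *: _); rewrite /= subn0 !mul1n.
  by case: N mN {u} => // N _; rewrite factS natfMV.
have m'N := ltnW mN.
set mo := Ordinal mN; set mo' := Ordinal m'N.
rewrite big_ord_recl mul1r addn0 subn0 {1}/elem_sym -scalerAr.
rewrite (@inj_sum_newtonS _ _ u mo' mo) // scalerDr.
under eq_bigr => i _ do rewrite lift0 exprS -mulrA mulN1r mulNr addnS -addSn subSS mulrA.
rewrite sumrN -(IHm m'N j.+1) addrAC /= -!scaler_nat !scalerA.
(* The factor [m.+1] from the used positions turns the normalization into that of the induction
   hypothesis, so these terms cancel. *)
have -> : (m.+1`! * (N - m.+1)`!)%:R^-1 * m.+1%:R = (m`! * (N - m).-1`!)%:R^-1 :> F.
  by rewrite factS -subnS -mulnA natfMV.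
rewrite subrr add0r; congr (_ *: _).
(* Positivity lets the number of free positions cancel against the leading factor of its
   factorial. *)
have : (0 < N - m.+1)%N by rewrite subn_gt0.
case: (N - m.+1)%N => // r _.
by rewrite factS mulnCA natfMV.
Qed.

(** This is the case [j = 1]: a new index with exponent 1 simply lengthens the product, so $g_{m,1}
    = (m+1) e_{m+1}$. *)
Lemma newton_elem_sym (F : numFieldType) (A : comAlgType F) (N : nat) (u : 'I_N -> A)
    (m : nat) :
  (m < N)%N ->
  m.+1%:R *: elem_sym u m.+1
  = \sum_(i < m.+1) (-1) ^+ i * power_sum u i.+1 * elem_sym u (m - i).
Proof.
move=> mN; rewrite -(elem_sym_pow_sum u (Ordinal mN) 1) /elem_sym scalerA -inj_sumS /=.
by congr (_ *: _); rewrite factS -subnS -mulnA mulrC natfMV.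
Qed.

(** * Integration of monomials against measures *)

(** Values in a module allow polynomial-valued integrands; integrating [monom] yields the polynomial
    that encodes the measure. *)
Definition integ (R : realType) (A : lmodType R) (T : finType) (mu : fmeas R T)
    (f : T -> A) : A :=
  \sum_t (mu t : R) *: f t.

Lemma integ_push (R : realType) (A : lmodType R) (T U : finType) (g : T -> U)
    (mu : fmeas R T) (f : U -> A) :
  integ (push g mu) f = integ mu (f \o g).
Proof.
rewrite /integ (partition_big g xpredT) //=; apply: eq_bigr => u _.
by rewrite ffunE scaler_suml; apply: eq_bigr => t /eqP->.
Qed.

Lemma integ_dirac (R : realType) (A : lmodType R) (T : finType) (a : T) (f : T -> A) :
  integ (fdirac R a) f = f a.
Proof.
rewrite /integ (bigD1 a) //= ffunE eqxx scale1r big1 ?addr0 // => b ba.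
by rewrite ffunE eq_sym (negPf ba) scale0r.
Qed.

Lemma integZ (R : realType) (A : lmodType R) (T : finType) (c : R)
    (mu : fmeas R T) (f : T -> A) :
  integ (c *: mu) f = c *: integ mu f.
Proof. by rewrite /integ scaler_sumr; apply: eq_bigr => t _; rewrite ffunE scalerA. Qed.

Lemma integ_sum (R : realType) (A : lmodType R) (T I : finType)
    (mu : I -> fmeas R T) (f : T -> A) :
  integ (\sum_i mu i) f = \sum_i integ (mu i) f.
Proof.
rewrite /integ exchange_big /=; apply: eq_bigr => t _.
by rewrite sum_ffunE scaler_suml.
Qed.

Definition monom (A : comNzRingType) (X : finType) (t : X -> A) (n : nat)
  (y : {ffun 'I_n -> X}) : A := \prod_i t (y i).

Lemma integ_tensor (R : realType) (A : comAlgType R) (X : finType) (t : X -> A) (m n : nat)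
    (mu : fmeas R {ffun 'I_m -> X}) (nu : fmeas R {ffun 'I_n -> X}) :
  integ (tensor mu nu) (@monom _ _ t (m + n))
  = integ mu (@monom _ _ t m) * integ nu (@monom _ _ t n).
Proof.
rewrite /tensor integ_push /integ mulr_suml.
under [RHS]eq_bigr do rewrite mulr_sumr.
rewrite pair_big /=; apply: eq_bigr => -[y z] _; rewrite ffunE /=.
rewrite -scalerAl -scalerAr scalerA; congr (_ *: _).
rewrite /monom big_split_ord /=; congr (_ * _); apply: eq_bigr => i _; rewrite ffunE.
  by rewrite (unsplitK (inl i)).
by rewrite (unsplitK (inr i)).
Qed.

Lemma integ_diag_tensor (R : realType) (A : comAlgType R) (X : finType) (t : X -> A)
    (lambda : fmeas R X) (p : seq nat) :
  integ (diag_tensor lambda p) (@monom _ _ t (sumn p))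
  = \prod_(q <- p) integ lambda (fun x => t x ^+ q).
Proof.
elim: p => [|q p IHp] /=; first by rewrite integ_dirac /monom big_ord0 big_nil.
rewrite integ_tensor IHp big_cons integ_push; congr (_ * _).
apply: eq_bigr => x _; congr (_ *: _); rewrite /= /monom.
under eq_bigr do rewrite ffunE.
by rewrite prodr_const card_ord.
Qed.

(** A commutative product does not see the order of the coordinates, so all [n!] terms of the
    average agree. *)
Lemma integ_symm (R : realType) (A : comAlgType R) (X : finType) (t : X -> A) (n : nat)
    (mu : fmeas R {ffun 'I_n -> X}) :
  integ (symm mu) (@monom _ _ t n) = integ mu (@monom _ _ t n).
Proof.
have nf0 : n`!%:R != 0 :> R by rewrite pnatr_eq0 -lt0n fact_gt0.
rewrite /symm integZ integ_sum (eq_bigr (fun=> integ mu (@monom _ _ t n))) => [|s _].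
  by rewrite sumr_const card_Sn -scaler_nat scalerA mulVf ?scale1r.
rewrite integ_push; apply: eq_bigr => y _; congr (_ *: _).
rewrite /monom [RHS](reindex_inj (@perm_inj _ s)) /=.
by apply: eq_bigr => i _; rewrite ffunE.
Qed.

Lemma integ_intpartn_tensor (R : realType) (A : comAlgType R) (X : finType) (t : X -> A)
    (k : nat) (lambda : fmeas R X) (p : intpartn k) :
  integ (intpartn_tensor lambda p) (@monom _ _ t k)
  = \prod_(q <- p) integ lambda (fun x => t x ^+ q).
Proof.
rewrite /intpartn_tensor integ_push -integ_diag_tensor.
apply: eq_bigr => y _; congr (_ *: _); rewrite /= /monom.
have bij_c : bijective (cast_ord (esym (sumn_intpartn p))).
  by exists (cast_ord (sumn_intpartn p)); [apply: cast_ordKV | apply: cast_ordK].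
rewrite [RHS](reindex _ (onW_bij _ bij_c)) /=.
by apply: eq_bigr => i _; rewrite ffunE.
Qed.

Lemma integ_one_point (R : realType) (A : lmodType R) (X : finType) (N : nat)
    (x : {ffun 'I_N -> X}) (f : X -> A) :
  integ (one_point R x) f = N%:R^-1 *: \sum_i f (x i).
Proof. by rewrite integZ integ_sum; under eq_bigr do rewrite integ_dirac. Qed.

(** * Exchangeable measures and injectivity of the encoding *)

Definition exchangeable (R : realType) (X : finType) (n : nat)
    (mu : fmeas R {ffun 'I_n -> X}) : Prop :=
  forall (s : 'S_n) (y : {ffun 'I_n -> X}), mu [ffun i => y (s i)] = mu y.

Lemma symm_exchangeable (R : realType) (X : finType) (n : nat)
    (mu : fmeas R {ffun 'I_n -> X}) : exchangeable (symm mu).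
Proof.
move=> s y; rewrite !ffunE !sum_ffunE; congr (_ *: _).
rewrite (reindex_inj (mulgI s)) /=; apply: eq_bigr => r _; rewrite !ffunE.
apply: eq_bigl => z; apply/eqP/eqP => [/ffunP E|<-]; apply/ffunP => i.
  by have := E (s^-1 i)%g; rewrite !ffunE permM permKV.
by rewrite !ffunE permM.
Qed.

(** A permutation of the first [k] coordinates extends to all [N] of them and is absorbed by the
    average over ['S_N]. *)
Lemma extremal_exchangeable (R : realType) (X : finType) (N k : nat) (hkN : (k <= N)%N)
    (x : {ffun 'I_N -> X}) : exchangeable (extremal R hkN x).
Proof.
move=> s y.
(* [insub] tests whether [l] lies below [k]; the default value [l] makes [ext r] the identity
   elsewhere. *)
pose ext (r : 'S_k) (l : 'I_N) : 'I_N := oapp (fun i => widen_ord hkN (r i)) l (insub (val l)).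
have extE r i : ext r (widen_ord hkN i) = widen_ord hkN (r i).
  by rewrite /ext valK.
have extK : cancel (ext s) (ext s^-1%g).
  move=> l; case: (ltnP l k) => lk.
    have -> : l = widen_ord hkN (Ordinal lk) by apply: val_inj.
    by rewrite !extE permK.
  by rewrite /ext !insubN -?leqNgt.
pose sx := perm (can_inj extK).
rewrite /extremal /marginal /symm push_scale_sum !(ffunE, sum_ffunE); congr (_ *: _).
rewrite (reindex_inj (mulgI sx)) /=; apply: eq_bigr => r _.
rewrite !push_dirac !ffunE; congr (nat_of_bool _)%:R.
apply/eqP/eqP => /ffunP E; apply/ffunP => i.
  by have := E (s^-1 i)%g; rewrite !ffunE permM permE extE permKV.
by have := E (s i); rewrite !ffunE permM permE extE.
Qed.

(** The exponents of the monomial of [y] count the occurrences of each point, so they determine [y]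
    up to permutation. The coefficient there is the value at [y] times the size of its orbit, which
    is nonzero. *)
Lemma exchangeable_inj (R : realType) (X : finType) (n : nat)
    (mu nu : fmeas R {ffun 'I_n -> X})
    (t := fun x : X => 'X_(enum_rank x) : {mpoly R[#|X|]}) :
    exchangeable mu -> exchangeable nu ->
  integ mu (@monom _ _ t n) = integ nu (@monom _ _ t n) -> mu = nu.
Proof.
pose m (y : {ffun 'I_n -> X}) := (\sum_i U_(enum_rank (y i)))%MM.
have mE y : @monom _ _ t n y = 'X_[m y] by rewrite /monom mprodXE.
have perm_m y z : m y = m z -> exists s : 'S_n, y = [ffun i => z (s i)].
  move=> /mnmP yz.
  have count_y (w : {ffun 'I_n -> X}) a :
      count_mem a [tuple w i | i < n] = m w (enum_rank a).
    rewrite mnm_sumE -sum1_count big_map big_mkcond /= big_enum /=.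
    by apply: eq_bigr => i _; rewrite mnmE (inj_eq enum_rank_inj); case: eqP.
  have : perm_eq [tuple y i | i < n] [tuple z i | i < n].
    apply/allP => a _ /=; apply/eqP.
    by rewrite !count_y yz.
  case/tuple_permP => s /val_inj E; exists s; apply/ffunP => i.
  by have := congr1 (fun r => tnth r i) E; rewrite !tnth_mktuple ffunE.
have coefE (ka : fmeas R {ffun 'I_n -> X}) y : exchangeable ka ->
    (integ ka (@monom _ _ t n))@_(m y) = ka y *+ #|[pred z | m z == m y]|.
  move=> kaE; rewrite /integ raddf_sum -sumr_const [RHS]big_mkcond /=.
  apply: eq_bigr => z _; rewrite mE mcoeffZ mcoeffX inE.
  case: eqP => [/perm_m[s ->]|_]; last by rewrite mulr0.
  by rewrite mulr1 kaE.
move=> muE nuE mu_nu; apply/ffunP => y.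
have := coefE mu y muE; rewrite mu_nu coefE // => /eqP.
rewrite -subr_eq0 -mulrnBl mulrn_eq0 subr_eq0 => /orP[|/eqP->//].
by move/eqP/card0_eq/(_ y); rewrite inE eqxx.
Qed.

(** * The coefficients and the expansion *)

(** At $\theta=-N$ the rising factorial is $(-1)^k$ times the falling factorial of $N$, and
    $\theta^n$ contributes $(-1)^n$; together the signs give $(-1)^{k-n}$. *)
Lemma coef_ew (R : realType) (N k : nat) (p : intpartn k) :
  (coef R N p)%:C = ew p (- N%:R).
Proof.
have ffE : \prod_(j < k) (- N%:R + j%:R) = (-1) ^+ k * (N ^_ k)%:R :> R[i].
  elim: k {p} => [|k IHk]; first by rewrite big_ord0 mul1r.
  rewrite big_ord_recr /= IHk ffactnSr natrM exprSr -!mulrA; congr (_ * _).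
  (* Past [N] the subtraction [N - k] truncates, but the falling factorial already vanishes. *)
  rewrite mulrCA mulN1r; case: (leqP k N) => [le_kN|lt_Nk].
    by rewrite natrB // opprB addrC.
  by rewrite ffact_small // !mul0r.
rewrite /coef /ew ffE !rmorphM !rmorphXn !fmorphV !rmorph_prod rmorphN rmorph1 !rmorph_nat.
under eq_bigr do rewrite rmorph_nat.
rewrite prodfV.
under [X in _ * X^-1 = _]eq_bigr do rewrite rmorph_nat.
congr (_ * _); congr (_ * _).
suff -> : (-1) ^+ (k - size p) = ((-1) ^+ k)^-1 * (-1) ^+ size p :> R[i].
  rewrite [(- N%:R) ^+ _]exprNn invfM. ring.
by rewrite -signr_odd oddB ?size_intpartn // signr_addb !signr_odd -exprVn invrN1.
Qed.

(** The signs put into the weights make the recursion of [part_sum] coincide with Newton's, and both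
    sides are 1 in degree 0. *)
Lemma elem_sym_part_sum (F : numFieldType) (A : comAlgType F) (N : nat) (u : 'I_N -> A)
    (m : nat) :
  (m <= N)%N -> elem_sym u m = part_sum (fun q => (-1) ^+ q.-1 * power_sum u q) m.
Proof.
elim/ltn_ind: m => -[|m] IHm mN; first by rewrite elem_sym0 part_sum0.
have m0 : m.+1%:R != 0 :> F by rewrite pnatr_eq0.
apply: (scalerI m0); rewrite newton_elem_sym // part_sumS; apply: eq_bigr => i _.
by rewrite IHm // ?ltnS ?leq_subr // (leq_trans (leq_subr _ _)) // ltnW.
Qed.

(** It collects the signs $(-1)^{q-1}$ of the parts into the sign $(-1)^{k-n}$ of [coef]. *)
Lemma sumn_pred (s : seq nat) :
  all (ltn 0) s -> (\sum_(q <- s) q.-1 = sumn s - size s)%N.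
Proof.
move=> s0; have -> : sumn s = (\sum_(q <- s) q.-1 + size s)%N; last by rewrite addnK.
elim: s s0 => [|[|q] s IHs] //= s0; first by rewrite big_nil.
by rewrite big_cons IHs //= addSn addnS addnA.
Qed.

(** The power of [N] in [coef] cancels the factors [1 / N] of the normalized power sums, one for
    each part. *)
Lemma coef_part_weight (R : realType) (A : comAlgType R) (N k : nat) (P : nat -> A)
    (p : intpartn k) : (0 < N)%N ->
  coef R N p *: \prod_(q <- p) (N%:R^-1 *: P q)
  = (k`!%:R / (N ^_ k)%:R) *: part_weight (fun q => (-1) ^+ q.-1 * P q) p.
Proof.
move=> N_gt0; have N0 : N%:R != 0 :> R by rewrite pnatr_eq0 -lt0n.
case/and3P: (partsP p) => _ p0 /eqP sump.
have -> : \prod_(q <- p) (N%:R^-1 *: P q) = N%:R ^- size p *: \prod_(q <- p) P q.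
  elim: (parts p) => [|q s IHs]; first by rewrite !big_nil invr1 scale1r.
  by rewrite !big_cons IHs -scalerAl -scalerAr scalerA exprS invfM.
rewrite /part_weight big_split /= prodrXr sumn_pred // sump.
rewrite -signr_odd mulr_sign -scaler_sign signr_odd !scalerA; congr (_ *: _).
rewrite /coef /zpart natrM !natr_prod invfM.
have cancel_mid (s f y z c : R) : y != 0 -> s * f * y * z * c / y = f * (z * c) * s.
  by move=> y0; field.
exact: cancel_mid (expf_neq0 _ N0).
Qed.

(** The average over ['S_N] is [inj_sum] divided by [N!], and [N! = (N ^_ k) (N - k)!] converts this
    to the normalization of [elem_sym]. *)
Lemma integ_extremal (R : realType) (A : comAlgType R) (X : finType) (t : X -> A) (N k : nat)
    (hkN : (k <= N)%N) (x : {ffun 'I_N -> X}) :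
  integ (extremal R hkN x) (@monom _ _ t k)
  = (k`!%:R / (N ^_ k)%:R) *: elem_sym (fun i => t (x i)) k.
Proof.
rewrite /extremal /marginal /symm integ_push integZ integ_sum /elem_sym scalerA.
have nf0 n : n`!%:R != 0 :> R by rewrite pnatr_eq0 -lt0n fact_gt0.
have -> : k`!%:R / (N ^_ k)%:R * (k`! * (N - k)`!)%:R^-1 = N`!%:R^-1 :> R.
  by rewrite -(ffact_fact hkN) !natrM !invfM mulrACA mulfV // mul1r.
congr (_ *: _); apply: eq_bigr => s _; rewrite push_dirac integ_dirac /monom.
rewrite [RHS](big_ord_narrow hkN) /=.
by apply: eq_bigr => i _; rewrite !ffunE.
Qed.

Theorem theorem7p2 (R : realType) (N k : nat)
    (hN : (2 <= N)%N) (hk : (2 <= k)%N) (hkN : (k <= N)%N) :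
  (forall (X : finType) (x : {ffun 'I_N -> X}),
     extremal R hkN x
     = \sum_(p : intpartn k) coef R N p *: symm (intpartn_tensor (one_point R x) p))
  /\ (forall p : intpartn k, (coef R N p)%:C = ew p (- N%:R)).
Proof.
have N_gt0 : (0 < N)%N by apply: leq_trans hN.
split=> [X x|p]; last exact: coef_ew.
apply: exchangeable_inj.
- exact: extremal_exchangeable.
- move=> s y; rewrite !sum_ffunE; apply: eq_bigr => p _.
  have := symm_exchangeable (intpartn_tensor (one_point R x) p) s y.
  by rewrite !ffunE => ->.
(* Both encodings are now sums over partitions of [k], and they agree term by term. *)
rewrite integ_extremal elem_sym_part_sum // scaler_sumr integ_sum.
apply: eq_bigr => p _; rewrite -coef_part_weight // integZ integ_symm integ_intpartn_tensor.
by congr (_ *: _); apply: eq_bigr => q _; rewrite integ_one_point.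
Qed.
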